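(* Let $a,b,q$ be complex numbers with $|q|<1$ and $a,b\neq -q^{-N}$ for any positive integer $N$. Then $$(-bq;q)_{\infty}\sum_{n=0}^{\infty}\frac{a^nq^{n(n+1)/2}}{(q;q)_n(-bq;q)_n}=(-aq;q)_{\infty}\sum_{n=0}^{\infty}\frac{b^nq^{n(n+1)/2}}{(q;q)_n(-aq;q)_n}.$$
   Context: Notation: $(x;q)_0=1$, $(x;q)_n=\prod_{j=0}^{n-1}(1-xq^{j})$ for $n\ge 1$, and $(x;q)_\infty=\prod_{j=0}^{\infty}(1-xq^{j})$. The condition $a,b\ne -q^{-N}$ means $1+aq^N\neq 0$ and $1+bq^N\ne 0$. *)

(* Defs.v *)
From Stdlib Require Import Reals.
From Coquelicot Require Import Coquelicot.
Local Open Scope C_scope.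

(* (x;q)_n = \prod_(j < n) (1 - x q^j) *)
Fixpoint qpoch (x q : C) (n : nat) : C :=
  match n with
  | O => 1
  | S m => qpoch x q m * (1 - x * q ^ m)
  end.

(* (x;q)_oo = l: the partial products converge to l, which may be 0 *)
Definition is_qpoch_inf (x q l : C) : Prop :=
  filterlim (qpoch x q) eventually (locally l).

(* Main.v *)
(** The identity is the limit of a finite one.  Let [K; n] be the q-binomial
    coefficient.  Expanding (-b q^(n+1); q)_(K-n) by the q-binomial theorem gives
      (-bq;q)_K sum_(n <= K) [K; n] a^n q^(n(n+1)/2) / (-bq;q)_n
        = sum_(n + m <= K) (K; n, m)_q q^((n+m)(n+m+1)/2) a^n b^m
    with q-trinomial coefficients, and the right-hand side is symmetric in (a, b).
    Tannery's theorem allows K -> oo: the product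
    (1 - q^K) ... (1 - q^(K-n+1)) tends to 1 and is bounded by 2^n, while
    the terms of the limit series decay superexponentially. *)
Require Import Defs.
From Stdlib Require Import Reals Lra Lia.
From Coquelicot Require Import Coquelicot.
Local Open Scope C_scope.

(* [ring] and [field] do not see [C] through Coquelicot's canonical structures. *)
Ltac C_ops :=
  lazymatch goal with |- ?x = ?y => change (@eq C x y) end;
  change (@plus C_AbelianMonoid) with Cplus in *;
  change (@mult C_Ring) with Cmult in *.

(** * Limits of complex sequences through real moduli, and a ratio test *)

Lemma filterlim_Cmod (u : nat -> C) (l : C) :
  filterlim u eventually (locally l) <->
  is_lim_seq (fun n => Cmod (u n - l)) 0.
Proof.
  split; intros H.
  - apply is_lim_seq_spec; intros eps.
    destruct (proj1 (filterlim_locally_ball_norm (U := C_NormedModule) u l) H eps)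
      as [N HN].
    exists N; intros n hn; specialize (HN n hn).
    change (Cmod (u n - l) < eps)%R in HN.
    rewrite Rminus_0_r, Rabs_pos_eq by apply Cmod_ge_0; exact HN.
  - apply (filterlim_locally_ball_norm (U := C_NormedModule) u l); intros eps.
    apply is_lim_seq_spec in H; destruct (H eps) as [N HN].
    exists N; intros n hn; specialize (HN n hn).
    rewrite Rminus_0_r, Rabs_pos_eq in HN by apply Cmod_ge_0.
    exact HN.
Qed.

Lemma is_lim_seq_0_le (u v : nat -> R) :
  (forall n, 0 <= u n <= v n)%R -> is_lim_seq v 0 -> is_lim_seq u 0.
Proof.
  intros H Hv.
  apply (is_lim_seq_le_le (fun _ => 0%R) u v); auto using is_lim_seq_const.
Qed.

Lemma filterlim_Cmult (u v : nat -> C) (l m : C) :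
  filterlim u eventually (locally l) ->
  filterlim v eventually (locally m) ->
  filterlim (fun n => u n * v n) eventually (locally (l * m)).
Proof.
  rewrite !filterlim_Cmod; intros Hu Hv.
  apply is_lim_seq_0_le with (fun n =>
    Cmod (u n - l) * Cmod (v n - m)
    + (Cmod l * Cmod (v n - m) + Cmod m * Cmod (u n - l)))%R.
  - intros n; split; [apply Cmod_ge_0|].
    replace (u n * v n - l * m)
      with ((u n - l) * (v n - m) + (l * (v n - m) + m * (u n - l))) by ring.
    rewrite <- !Cmod_mult.
    eapply Rle_trans; [apply Cmod_triangle|].
    apply Rplus_le_compat_l, Cmod_triangle.
  - replace (Finite 0) with (Finite (0 * 0 + (Cmod l * 0 + Cmod m * 0)))
      by (f_equal; ring).
    apply is_lim_seq_plus'; [apply is_lim_seq_mult'; assumption|].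
    apply is_lim_seq_plus'; apply is_lim_seq_mult'; auto using is_lim_seq_const.
Qed.

Lemma filterlim_one_minus (z : nat -> C) :
  is_lim_seq (fun n => Cmod (z n)) 0 ->
  filterlim (fun n => 1 - z n) eventually (locally (1 : C)).
Proof.
  intros H; apply filterlim_Cmod.
  eapply is_lim_seq_ext; [|exact H]; intros n; simpl.
  rewrite <- Cmod_opp; f_equal; ring.
Qed.

Lemma is_lim_seq_Cmod_one_minus (z : nat -> C) :
  is_lim_seq (fun n => Cmod (z n)) 0 ->
  is_lim_seq (fun n => Cmod (1 - z n)) 1.
Proof.
  intros H.
  apply (is_lim_seq_le_le (fun n => 1 - Cmod (z n))%R _ (fun n => 1 + Cmod (z n))%R).
  - intros n; split.
    + pose proof (Cmod_triangle (1 - z n) (z n)) as T.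
      replace (1 - z n + z n) with (1 : C) in T by ring.
      rewrite Cmod_1 in T; lra.
    + pose proof (Cmod_triangle 1 (- z n)) as T.
      rewrite Cmod_1, Cmod_opp in T; exact T.
  - replace (Finite 1) with (Finite (1 - 0)) by (f_equal; ring).
    apply is_lim_seq_minus'; auto using is_lim_seq_const.
  - replace (Finite 1) with (Finite (1 + 0)) by (f_equal; ring).
    apply is_lim_seq_plus'; auto using is_lim_seq_const.
Qed.

Lemma is_lim_seq_Cmod_geom (x q : C) :
  (Cmod q < 1)%R -> is_lim_seq (fun n => Cmod (x * q ^ n)) 0.
Proof.
  intros hq.
  replace (Finite 0) with (Finite (Cmod x * 0)) by (f_equal; ring).
  apply is_lim_seq_ext with (fun n => Cmod x * Cmod q ^ n)%R.
  { intros n; rewrite Cmod_mult, Cmod_pow; reflexivity. }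
  apply is_lim_seq_mult'; [apply is_lim_seq_const|].
  apply is_lim_seq_geom; rewrite Rabs_pos_eq by apply Cmod_ge_0; exact hq.
Qed.

(* Unlike [ex_series_DAlembert], the terms may vanish. *)
Lemma ex_series_ratio (d rho : nat -> R) (l : R) :
  (forall n, 0 <= d n)%R ->
  (forall n, d (S n) <= rho n * d n)%R ->
  is_lim_seq rho l -> (l < 1)%R -> ex_series d.
Proof.
  intros hd hr hl l1.
  (* The midpoint of [l] and 1 bounds the ratios eventually; the maximum with 0 covers a negative
     [l], since the induction multiplies inequalities by [r]. *)
  set (r := Rmax ((l + 1) / 2) 0).
  assert (r1 : (0 <= r < 1)%R).
  { unfold r; split; [apply Rmax_r|apply Rmax_lub_lt; lra]. }
  assert (lr : (l < r)%R).
  { unfold r; apply Rlt_le_trans with ((l + 1) / 2)%R; [lra|apply Rmax_l]. }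
  assert (He : (0 < r - l)%R) by lra.
  apply is_lim_seq_spec in hl; destruct (hl (mkposreal _ He)) as [N HN].
  assert (hN : forall k, (d (N + k)%nat <= d N * r ^ k)%R).
  { induction k as [|k IH].
    - rewrite Nat.add_0_r; simpl; lra.
    - rewrite Nat.add_succ_r; eapply Rle_trans; [apply hr|].
      assert (Hk : (N <= N + k)%nat) by lia.
      specialize (HN _ Hk); simpl in HN; apply Rabs_def2 in HN.
      apply Rle_trans with (r * d (N + k)%nat)%R.
      + apply Rmult_le_compat_r; [apply hd|lra].
      + simpl; replace (d N * (r * r ^ k))%R with (r * (d N * r ^ k))%R by ring.
        apply Rmult_le_compat_l; [lra|exact IH]. }
  apply (ex_series_incr_n d N).
  apply (ex_series_le (fun k => d (N + k)%nat) (fun k => scal (d N) (r ^ k)%R)).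
  - intros k; change (Rabs (d (N + k)%nat) <= d N * r ^ k)%R.
    rewrite Rabs_pos_eq by apply hd; apply hN.
  - apply (ex_series_scal (V := R_NormedModule)), ex_series_geom.
    rewrite Rabs_pos_eq; lra.
Qed.

(** * Tannery's theorem for sums whose length grows with the parameter *)

Lemma Cmod_sum_n_le (f : nat -> C) (n : nat) :
  (Cmod (sum_n f n) <= sum_n (fun k => Cmod (f k)) n)%R.
Proof.
  induction n as [|n IH].
  - rewrite !sum_O; lra.
  - rewrite !sum_Sn; eapply Rle_trans; [apply Cmod_triangle|].
    apply Rplus_le_compat_r, IH.
Qed.

Lemma is_lim_seq_sum_n (f : nat -> nat -> R) (g : nat -> R) (N : nat) :
  (forall n, is_lim_seq (fun K => f K n) (g n)) ->
  is_lim_seq (fun K => sum_n (f K) N) (sum_n g N).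
Proof.
  intros H; induction N as [|N IH].
  - rewrite sum_O; eapply is_lim_seq_ext; [|apply H].
    intros K; rewrite sum_O; reflexivity.
  - rewrite sum_Sn.
    apply is_lim_seq_ext with (fun K => sum_n (f K) N + f K (S N))%R.
    { intros K; rewrite sum_Sn; reflexivity. }
    apply (is_lim_seq_plus' _ _ _ _ IH (H (S N))).
Qed.

(** Cut the sum at an [N] beyond which every block of [d] is below [eps / 2]. The part past [N] is
    then small uniformly in [K], and the part up to [N] is a fixed finite sum of null sequences. *)
Lemma tannery_nonneg (u : nat -> nat -> R) (d : nat -> R) :
  (forall K n, 0 <= u K n <= d n)%R -> ex_series d ->
  (forall n, is_lim_seq (fun K => u K n) 0) ->
  is_lim_seq (fun K => sum_n (u K) K) 0.
Proof.
  intros hu hd hl.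
  apply is_lim_seq_spec; intros eps.
  assert (He : (0 < eps / 2)%R) by (destruct eps; simpl; lra).
  destruct (Cauchy_ex_series d hd (mkposreal _ He)) as [N HN].
  pose proof (is_lim_seq_sum_n u (fun _ => 0%R) N hl) as HS.
  rewrite sum_n_const, Rmult_0_r in HS.
  apply is_lim_seq_spec in HS; destruct (HS (mkposreal _ He)) as [M HM].
  exists (S (Nat.max N M)); intros K hK.
  specialize (HM K ltac:(lia)); specialize (HN (S N) K ltac:(lia) ltac:(lia)).
  simpl in HM, HN; change norm with Rabs in HN.
  rewrite Rminus_0_r in *.
  apply Rabs_def2, proj1 in HM; apply Rabs_def2, proj1 in HN.
  assert (T : (sum_n_m (u K) (S N) K <= sum_n_m d (S N) K)%R).
  { apply sum_n_m_le; intros k; apply hu. }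
  rewrite (sum_n_m_sum_n (u K)) in T by lia.
  change (sum_n (u K) K - sum_n (u K) N <= sum_n_m d (S N) K)%R in T.
  assert (P : (0 <= sum_n (u K) K)%R).
  { rewrite <- (Rmult_0_r (INR (S K))), <- sum_n_const.
    apply sum_n_m_le; intros k; apply hu. }
  rewrite Rabs_pos_eq by exact P.
  apply Rle_lt_trans with (sum_n (u K) N + sum_n_m d (S N) K)%R; [lra|].
  replace (pos eps) with (eps / 2 + eps / 2)%R by field.
  apply Rplus_lt_compat; [exact HM|exact HN].
Qed.

Lemma sum_n_Cminus (f g : nat -> C) (n : nat) :
  sum_n (fun k => f k - g k) n = sum_n f n - sum_n g n.
Proof.
  induction n as [|n IH].
  - rewrite !sum_O; reflexivity.
  - rewrite !sum_Sn, IH; C_ops; ring.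
Qed.

(** The nonnegative case applies to the moduli of [f K n - g n]; what remains is the distance from
    the partial sum of [g] to [l]. *)
Lemma tannery (f : nat -> nat -> C) (g : nat -> C) (d : nat -> R) (l : C) :
  (forall K n, Cmod (f K n - g n) <= d n)%R -> ex_series d ->
  (forall n, filterlim (fun K => f K n) eventually (locally (g n))) ->
  is_series g l ->
  filterlim (fun K => sum_n (f K) K) eventually (locally l).
Proof.
  intros hf hd hl hg.
  change (filterlim (sum_n g) eventually (locally l)) in hg.
  rewrite filterlim_Cmod in hg |- *.
  apply is_lim_seq_0_le with (fun K =>
    sum_n (fun n => Cmod (f K n - g n)) K + Cmod (sum_n g K - l))%R.
  - intros K; split; [apply Cmod_ge_0|].
    eapply Rle_trans; [|apply Rplus_le_compat_r, Cmod_sum_n_le].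
    rewrite sum_n_Cminus.
    replace (sum_n (f K) K - l)
      with (sum_n (f K) K - sum_n g K + (sum_n g K - l)) by ring.
    apply Cmod_triangle.
  - replace (Finite 0) with (Finite (0 + 0)) by (f_equal; ring).
    apply is_lim_seq_plus'; [|exact hg].
    apply tannery_nonneg with d; [|exact hd|].
    + intros K n; split; [apply Cmod_ge_0|apply hf].
    + intros n; apply filterlim_Cmod, hl.
Qed.

(** * Triangular numbers and finite q-products *)

Definition tri (n : nat) : nat := (n * (n + 1) / 2)%nat.

Lemma tri_S (n : nat) : tri (S n) = (tri n + S n)%nat.
Proof.
  unfold tri.
  replace (S n * (S n + 1))%nat with (n * (n + 1) + S n * 2)%nat by ring.
  apply Nat.div_add; discriminate.
Qed.

(** The cross term [n * m] is what later turns [b ^ m] into [(b * q ^ n) ^ m]. *)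
Lemma tri_add (n m : nat) : tri (n + m) = (tri n + tri m + n * m)%nat.
Proof.
  induction n as [|n IH]; [simpl; change (tri 0) with 0%nat; lia|].
  simpl Nat.add; rewrite !tri_S, IH; ring.
Qed.

(* [\prod_(j < n) (1 - q^(K-j))], so that the q-binomial coefficient [K, n] is
   [qfall q K n / qpoch q q n].  For [n > K] the factor [j = K] vanishes, whatever
   the truncated subtraction gives afterwards. *)
Fixpoint qfall (q : C) (K n : nat) : C :=
  match n with
  | O => 1
  | S m => qfall q K m * (1 - q ^ (K - m))
  end.

Lemma qfall_gt (q : C) (K n : nat) : (K < n)%nat -> qfall q K n = 0.
Proof.
  induction 1 as [|n _ IH]; simpl.
  - rewrite Nat.sub_diag; simpl; ring.
  - rewrite IH; ring.
Qed.

(** Splits off the first factor of the product instead of the last. Truncation is harmless because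
    [S K - S n] and [K - n] agree in every case. *)
Lemma qfall_SS (q : C) (K n : nat) :
  qfall q (S K) (S n) = (1 - q ^ S K) * qfall q K n.
Proof.
  induction n as [|n IH].
  - simpl; ring.
  - change (qfall q (S K) (S (S n))) with (qfall q (S K) (S n) * (1 - q ^ (S K - S n))).
    rewrite IH; simpl; ring.
Qed.

Lemma qfall_add (q : C) (K n m : nat) :
  qfall q K (n + m) = qfall q K n * qfall q (K - n) m.
Proof.
  induction m as [|m IH].
  - rewrite Nat.add_0_r; simpl; ring.
  - rewrite Nat.add_succ_r; simpl; rewrite IH, Nat.sub_add_distr; ring.
Qed.

Lemma Cmod_qfall_le (q : C) (K n : nat) :
  (Cmod q < 1)%R -> (Cmod (qfall q K n) <= 2 ^ n)%R.
Proof.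
  intros hq; induction n as [|n IH]; simpl.
  - rewrite Cmod_1; lra.
  - rewrite Cmod_mult, Rmult_comm.
    apply Rmult_le_compat; try apply Cmod_ge_0; [|exact IH].
    eapply Rle_trans; [apply Cmod_triangle|].
    rewrite Cmod_1, Cmod_opp, Cmod_pow.
    assert (Cmod q ^ (K - n) <= 1 ^ (K - n))%R.
    { apply pow_incr; split; [apply Cmod_ge_0|lra]. }
    rewrite pow1 in *; lra.
Qed.

Lemma filterlim_qfall (q : C) (n : nat) :
  (Cmod q < 1)%R -> filterlim (fun K => qfall q K n) eventually (locally (1 : C)).
Proof.
  intros hq; induction n as [|n IH]; simpl.
  - apply filterlim_const.
  - enough (H : filterlim (fun K => 1 - q ^ (K - n)) eventually (locally (1 : C))).
    { pose proof (filterlim_Cmult _ _ _ _ IH H) as L.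
      rewrite Cmult_1_l in L; exact L. }
    apply filterlim_one_minus.
    (* After shifting [K] by [n], the truncated difference becomes exactly [K]. *)
    apply (is_lim_seq_incr_n _ n).
    eapply is_lim_seq_ext; [|apply (is_lim_seq_Cmod_geom 1 q hq)].
    intros K; simpl; rewrite Nat.add_sub; f_equal; ring.
Qed.

Lemma qpoch_neq_0 (x q : C) (n : nat) :
  (forall k, (k < n)%nat -> 1 - x * q ^ k <> 0) -> qpoch x q n <> 0.
Proof.
  intros H; induction n as [|n IH]; simpl.
  - exact C1_nz.
  - apply Cmult_neq_0; auto.
Qed.

Lemma one_minus_pow_neq_0 (q : C) (n : nat) :
  (Cmod q < 1)%R -> 1 - q ^ S n <> 0.
Proof.
  intros hq H.
  assert (E : q ^ S n = 1) by (replace (1 : C) with (1 - q ^ S n + q ^ S n) by ring; rewrite H; ring).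
  apply (f_equal Cmod) in E; rewrite Cmod_pow, Cmod_1 in E; simpl in E.
  pose proof (Cmod_ge_0 q) as p.
  assert (P : (Cmod q ^ n <= 1 ^ n)%R) by (apply pow_incr; lra).
  rewrite pow1 in P.
  assert (0 <= Cmod q ^ n)%R by (apply pow_le; lra).
  nra.
Qed.

Lemma qpoch_qq_neq_0 (q : C) (n : nat) : (Cmod q < 1)%R -> qpoch q q n <> 0.
Proof.
  intros hq; apply qpoch_neq_0; intros k _.
  rewrite <- Cpow_S; apply one_minus_pow_neq_0, hq.
Qed.

(** * The q-binomial theorem *)

(** For [m <= M] this is [1 - q^(M+1) = (1 - q^(M-m)) + q^(M-m) * (1 - q^(m+1))] times a common
    factor. For [m > M] every term vanishes. *)
Lemma q_pascal (q : C) (M m : nat) :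
  (Cmod q < 1)%R ->
  qfall q (S M) (S m) / qpoch q q (S m) =
  qfall q M (S m) / qpoch q q (S m) + q ^ (M - m) * (qfall q M m / qpoch q q m).
Proof.
  intros hq.
  destruct (Nat.lt_ge_cases M m) as [h|h].
  - rewrite qfall_SS, !(qfall_gt q M) by lia; unfold Cdiv; ring.
  - rewrite qfall_SS.
    pose proof (qpoch_qq_neq_0 q m hq) as h1.
    pose proof (one_minus_pow_neq_0 q m hq) as h2.
    simpl qfall; simpl qpoch.
    replace (q ^ S M) with (q ^ (M - m) * (q * q ^ m))
      by (rewrite <- Cpow_S, <- Cpow_add_r; f_equal; lia).
    rewrite Cpow_S in h2.
    field; auto.
Qed.

Lemma sum_n_Sn_l (f : nat -> C) (n : nat) :
  sum_n f (S n) = f 0%nat + sum_n (fun k => f (S k)) n.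
Proof.
  induction n as [|n IH].
  - rewrite sum_Sn, !sum_O; reflexivity.
  - rewrite sum_Sn, IH, (sum_Sn (fun k => f (S k))); C_ops; ring.
Qed.

(** Induction on [M] by the Pascal rule. Terms past [M] vanish, so any [N >= M] may end the sum; the
    induction hypothesis is used at two different ends, and the double sum below keeps one end for
    all rows. *)
Lemma q_binomial (x q : C) (M N : nat) :
  (Cmod q < 1)%R -> (M <= N)%nat ->
  sum_n (fun m => qfall q M m / qpoch q q m * (q ^ tri m * x ^ m)) N
  = qpoch (- (x * q)) q M.
Proof.
  intros hq; revert N; induction M as [|M IH]; intros N hN.
  - destruct N as [|N]; [rewrite sum_O|rewrite sum_n_Sn_l].
    + simpl; field.
    + rewrite (sum_n_ext _ (fun _ => 0 * 0)).
      2:{ intros n; C_ops; rewrite qfall_gt by lia; unfold Cdiv; ring. }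
      rewrite (sum_n_mult_l (K := C_Ring)); C_ops; simpl; field.
  - destruct N as [|N]; [lia|].
    rewrite sum_n_Sn_l.
    (* In the second Pascal term, [q^(M-m) * q^(tri (m+1)) = q^(M+1) * q^(tri m)], so the factor
       [x * q ^ S M] comes out of the sum: it supplies the new factor of the product. *)
    rewrite (sum_n_ext _ (fun m => plus
      (qfall q M (S m) / qpoch q q (S m) * (q ^ tri (S m) * x ^ S m))
      (mult (x * q ^ S M) (qfall q M m / qpoch q q m * (q ^ tri m * x ^ m))))).
    2:{ intros m; rewrite q_pascal by exact hq.
        C_ops.
        destruct (Nat.lt_ge_cases M m) as [h|h].
        - rewrite !(qfall_gt q M) by lia; unfold Cdiv; ring.
        - rewrite tri_S, Cpow_add_r.
          replace (q ^ S M) with (q ^ (M - m) * q ^ S m)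
            by (rewrite <- Cpow_add_r; f_equal; lia).
          rewrite (Cpow_S x m); ring. }
    rewrite sum_n_plus, (sum_n_mult_l (K := C_Ring)).
    rewrite IH by lia.
    C_ops.
    rewrite Cplus_assoc.
    (* Both are the empty product, so the isolated term of index 0 rejoins the first sum. *)
    change (qfall q (S M) 0) with (qfall q M 0).
    rewrite <- (sum_n_Sn_l (fun m => qfall q M m / qpoch q q m * (q ^ tri m * x ^ m))).
    rewrite IH by lia.
    simpl; ring.
Qed.

(** * The finite identity and its symmetry *)

Lemma qpoch_add (x q : C) (n m : nat) :
  qpoch x q (n + m) = qpoch x q n * qpoch (x * q ^ n) q m.
Proof.
  induction m as [|m IH].
  - rewrite Nat.add_0_r; simpl; ring.
  - rewrite Nat.add_succ_r; simpl; rewrite IH, Cpow_add_r; ring.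
Qed.

Definition qterm (a b q : C) (n : nat) : C :=
  a ^ n * q ^ (n * (n + 1) / 2) / (qpoch q q n * qpoch (- (b * q)) q n).

(** The inner sum runs to [K] rather than [K - n]: the extra terms contain [qfall q K (n + m)] with
    [n + m > K], which is 0. On this square range the two sums can be exchanged directly. *)
Lemma finite_sum_eq (a b q : C) (K : nat) :
  (Cmod q < 1)%R -> (forall n, qpoch (- (b * q)) q n <> 0) ->
  qpoch (- (b * q)) q K * sum_n (fun n => qfall q K n * qterm a b q n) K =
  sum_n (fun n => sum_n (fun m =>
    qfall q K (n + m) / (qpoch q q n * qpoch q q m)
    * (q ^ tri (n + m) * (a ^ n * b ^ m))) K) K.
Proof.
  intros hq hb.
  rewrite <- (sum_n_mult_l (K := C_Ring)).
  apply sum_n_ext_loc; intros n hn; C_ops.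
  (* The inner sum is the q-binomial theorem at [x = b * q ^ n] and [M = K - n]; its value is the
     part of [qpoch (- (b * q)) q K] left after dividing by the first [n] factors. *)
  transitivity (a ^ n * q ^ tri n * qfall q K n / qpoch q q n *
    sum_n (fun m => qfall q (K - n) m / qpoch q q m * (q ^ tri m * (b * q ^ n) ^ m)) K).
  - rewrite q_binomial by (exact hq || lia).
    replace (qpoch (- (b * q)) q K)
      with (qpoch (- (b * q)) q n * qpoch (- (b * q) * q ^ n) q (K - n))
      by (rewrite <- qpoch_add; f_equal; lia).
    replace (- (b * q ^ n * q)) with (- (b * q) * q ^ n) by ring.
    unfold qterm; fold (tri n).
    specialize (hb n); pose proof (qpoch_qq_neq_0 q n hq).
    field; auto.
  - rewrite <- (sum_n_mult_l (K := C_Ring)); apply sum_n_ext; intros m.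
    C_ops.
    rewrite qfall_add, tri_add, !Cpow_add_r, Cpow_mult_l, Cpow_mult_r.
    pose proof (qpoch_qq_neq_0 q n hq); pose proof (qpoch_qq_neq_0 q m hq).
    field; auto.
Qed.

Lemma finite_symmetry (a b q : C) (K : nat) :
  (Cmod q < 1)%R ->
  (forall n, qpoch (- (a * q)) q n <> 0) ->
  (forall n, qpoch (- (b * q)) q n <> 0) ->
  qpoch (- (b * q)) q K * sum_n (fun n => qfall q K n * qterm a b q n) K =
  qpoch (- (a * q)) q K * sum_n (fun n => qfall q K n * qterm b a q n) K.
Proof.
  intros hq ha hb.
  rewrite !finite_sum_eq, sum_n_switch by assumption.
  apply sum_n_ext; intros n; apply sum_n_ext; intros m.
  rewrite (Nat.add_comm m n), (Cmult_comm (qpoch q q m)), (Cmult_comm (a ^ m)).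
  reflexivity.
Qed.

(** * Convergence and passage to the limit *)

(** Here [e n] is the increment between consecutive partial products. Since
    [e (S n) = (1 - x * q ^ n) * q * e n], the ratios of moduli are governed by a factor tending to
    [Cmod q < 1], and the increments sum absolutely. *)
Lemma ex_qpoch_inf (x q : C) :
  (Cmod q < 1)%R -> exists l, is_qpoch_inf x q l.
Proof.
  intros hq.
  set (e := fun n => qpoch x q n * (- x * q ^ n)).
  assert (He : ex_series (fun n => Cmod (e n))).
  { apply ex_series_ratio with (fun n => Cmod (1 - x * q ^ n) * Cmod q)%R (1 * Cmod q)%R.
    - intros n; apply Cmod_ge_0.
    - intros n; rewrite <- !Cmod_mult; apply Req_le; f_equal.
      unfold e; simpl; ring.
    - apply is_lim_seq_mult'; [|apply is_lim_seq_const].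
      apply is_lim_seq_Cmod_one_minus, is_lim_seq_Cmod_geom, hq.
    - lra. }
  destruct (ex_series_le (V := C_CompleteNormedModule) e _
    (fun n => Rle_refl _) He) as [l Hl].
  change (filterlim (sum_n e) eventually (locally l)) in Hl.
  exists (1 + l).
  assert (E : forall n, qpoch x q (S n) = 1 + sum_n e n).
  { induction n as [|n IH].
    - rewrite sum_O; unfold e; simpl; ring.
    - rewrite sum_Sn; C_ops; rewrite Cplus_assoc, <- IH.
      unfold e; simpl; ring. }
  unfold is_qpoch_inf; apply filterlim_Cmod, is_lim_seq_incr_1.
  apply filterlim_Cmod in Hl.
  eapply is_lim_seq_ext; [|exact Hl]; intros n; cbv beta.
  rewrite E; f_equal; ring.
Qed.

(** The weight [2 ^ n] is the bound on [qfall q K n], uniform in [K]. The ratio of successive terms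
    tends to 0 because of the numerator [q^(n+1)], while both denominators tend to 1. *)
Lemma ex_series_term (a b q : C) :
  (Cmod q < 1)%R -> (forall n, qpoch (- (b * q)) q n <> 0) ->
  ex_series (fun n => 2 ^ n * Cmod (qterm a b q n))%R.
Proof.
  intros hq hb.
  apply ex_series_ratio with (fun n => 2 * Cmod (a * q * q ^ n)
    * / (Cmod (1 - q * q ^ n) * Cmod (1 - - (b * q) * q ^ n)))%R
    (2 * 0 * / (1 * 1))%R.
  - intros n; apply Rmult_le_pos; [apply pow_le; lra|apply Cmod_ge_0].
  - intros n; apply Req_le.
    assert (h1 := hb (S n)); assert (h2 := qpoch_qq_neq_0 q (S n) hq).
    assert (h3 := hb n); assert (h4 := qpoch_qq_neq_0 q n hq).
    simpl qpoch in h1, h2.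
    assert (h5 : 1 - q * q ^ n <> 0) by (intros h; apply h2; rewrite h; ring).
    assert (h6 : 1 - - (b * q) * q ^ n <> 0) by (intros h; apply h1; rewrite h; ring).
    rewrite <- Cmod_mult, <- Cmod_inv by (apply Cmult_neq_0; assumption).
    transitivity (2 * 2 ^ n * Cmod (a * q * q ^ n * / ((1 - q * q ^ n) * (1 - - (b * q) * q ^ n)) * qterm a b q n))%R.
    + simpl (2 ^ S n)%R; f_equal; f_equal.
      unfold qterm; fold (tri n) (tri (S n)).
      rewrite tri_S, Cpow_add_r; simpl qpoch; simpl Cpow; field; auto.
    + rewrite !Cmod_mult; ring.
  - apply is_lim_seq_mult'.
    + apply is_lim_seq_mult'; [apply is_lim_seq_const|].
      apply is_lim_seq_Cmod_geom, hq.
    + apply (is_lim_seq_inv _ (1 * 1)%R); [|intros H; injection H; lra].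
      apply is_lim_seq_mult'; apply is_lim_seq_Cmod_one_minus, is_lim_seq_Cmod_geom, hq.
  - lra.
Qed.

Lemma finite_limit (a b q P : C) :
  (Cmod q < 1)%R -> (forall n, qpoch (- (b * q)) q n <> 0) ->
  is_qpoch_inf (- (b * q)) q P ->
  exists l : C, is_series (qterm a b q) l /\
    filterlim (fun K => qpoch (- (b * q)) q K
                        * sum_n (fun n => qfall q K n * qterm a b q n) K)
      eventually (locally (P * l)).
Proof.
  intros hq hb hP.
  pose proof (ex_series_term a b q hq hb) as Hd.
  assert (Hs : ex_series (qterm a b q)).
  { apply (ex_series_le (V := C_CompleteNormedModule) _ _) with (2 := Hd).
    intros n; change norm with Cmod.
    pose proof (pow_R1_Rle 2 n ltac:(lra)); pose proof (Cmod_ge_0 (qterm a b q n)).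
    nra. }
  destruct Hs as [l Hl]; exists l; split; [exact Hl|].
  apply filterlim_Cmult; [exact hP|].
  apply (tannery (fun K n => qfall q K n * qterm a b q n) (qterm a b q)
    (* The factor 2 comes from bounding the modulus of [qfall q K n - 1] by
       [2 ^ n + 1 <= 2 * 2 ^ n]. *)
    (fun n => scal 2 (2 ^ n * Cmod (qterm a b q n)))%R).
  - intros K n.
    replace (qfall q K n * qterm a b q n - qterm a b q n)
      with ((qfall q K n + - (1)) * qterm a b q n) by ring.
    rewrite Cmod_mult; change scal with Rmult.
    rewrite <- Rmult_assoc; apply Rmult_le_compat_r; [apply Cmod_ge_0|].
    eapply Rle_trans; [apply Cmod_triangle|].
    rewrite Cmod_opp, Cmod_1.
    pose proof (pow_R1_Rle 2 n ltac:(lra)); pose proof (Cmod_qfall_le q K n hq); lra.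
  - apply (ex_series_scal (V := R_NormedModule)), Hd.
  - intros n.
    pose proof (filterlim_Cmult _ _ _ _ (filterlim_qfall q n hq)
      (filterlim_const (qterm a b q n))) as L.
    rewrite Cmult_1_l in L; exact L.
  - exact Hl.
Qed.

Lemma qpoch_minus_neq_0 (x q : C) :
  (forall N : nat, (1 <= N)%nat -> 1 + x * q ^ N <> 0) ->
  forall n, qpoch (- (x * q)) q n <> 0.
Proof.
  intros h n; apply qpoch_neq_0; intros k _.
  replace (1 - - (x * q) * q ^ k) with (1 + x * q ^ S k) by (simpl; ring).
  apply h; lia.
Qed.

Theorem theorem4 (a b q : C)
  (hq : (Cmod q < 1)%R)
  (ha : forall N : nat, (1 <= N)%nat -> 1 + a * q ^ N <> 0)
  (hb : forall N : nat, (1 <= N)%nat -> 1 + b * q ^ N <> 0) :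
  exists Pa Pb Sa Sb : C,
    is_qpoch_inf (- (a * q)) q Pa /\
    is_qpoch_inf (- (b * q)) q Pb /\
    is_series (fun n : nat =>
      a ^ n * q ^ (n * (n + 1) / 2)
        / (qpoch q q n * qpoch (- (b * q)) q n)) Sa /\
    is_series (fun n : nat =>
      b ^ n * q ^ (n * (n + 1) / 2)
        / (qpoch q q n * qpoch (- (a * q)) q n)) Sb /\
    Pb * Sa = Pa * Sb.
Proof.
  pose proof (qpoch_minus_neq_0 a q ha) as ha'.
  pose proof (qpoch_minus_neq_0 b q hb) as hb'.
  destruct (ex_qpoch_inf (- (a * q)) q hq) as [Pa hPa].
  destruct (ex_qpoch_inf (- (b * q)) q hq) as [Pb hPb].
  destruct (finite_limit a b q Pb hq hb' hPb) as [Sa [hSa La]].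
  destruct (finite_limit b a q Pa hq ha' hPa) as [Sb [hSb Lb]].
  exists Pa, Pb, Sa, Sb; repeat (split; [assumption|]).
  (* By the finite symmetry, the sequences behind [La] and [Lb] coincide term by term, so their
     limits [Pb * Sa] and [Pa * Sb] are equal. *)
  apply (filterlim_locally_unique (V := C_NormedModule) _ _ _ La).
  eapply filterlim_ext; [|exact Lb].
  intros K; apply finite_symmetry; assumption.
Qed.
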